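(* For every minimal set $S\subseteq\mathbb{N}$ there exists a set $B\subseteq\mathbb{N}$ that is both Besicovitch and taut and satisfies $B^*=S$.
   Context: $\mathbb{N}=\{1,2,\dots\}$. For $B\subseteq\mathbb{N}$ let $\mathcal{M}_B=\bigcup_{b\in B}b\mathbb{Z}$ and $\mathcal{F}_B=\mathbb{Z}\setminus\mathcal{M}_B$. For $A\subseteq\mathbb{Z}$, the natural density is $d(A)=\lim_{n\to\infty}\frac1n|A\cap[1,n]|$ (if it exists) and the logarithmic density is $\delta(A)=\lim_{n\to\infty}\frac{1}{\ln n}\sum_{1\le k\le n,\,k\in A}\frac1k$; $\delta(\mathcal{M}_B)$ exists for every $B\subseteq\mathbb{N}$ (Davenport--Erdős). $B$ is Besicovitch if $d(\mathcal{M}_B)$ exists. $B$ is taut if $\delta(\mathcal{M}_{B\setminus\{b\}})<\delta(\mathcal{M}_B)$ for every $b\in B$. $B$ is primitive if $b\mid b'$ with $b,b'\in B$ implies $b=b'$; $B^{prim}=B\setminus\bigcup_{k\ge2}kB$. $B$ is minimal if it is primitive and for every $n\in\mathbb{Z}$ there is $s_n\in\mathbb{N}$ such that either $n+s_n\mathbb{Z}\subseteq\mathcal{M}_B$ or $n+s_n\mathbb{Z}\subseteq\mathcal{F}_B$ (i.e. $\mathbf{1}_{\mathcal{F}_B}$ is a Toeplitz sequence). For $d\in\mathbb{N}$ and $A\subseteq\mathbb{N}$, $dA=\{da:a\in A\}$. Put $D(B)=\{d\in\mathbb{N}: dA\subseteq B\text{ for some infinite pairwise coprime set }A\subseteq\mathbb{N}\}$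 and define $B^*=(B\cup D(B))^{prim}$. *)

(* Defs.v *)
From mathcomp Require Import all_boot all_order all_algebra.
From mathcomp Require Import all_classical all_reals all_analysis.
Import Order.TTheory GRing.Theory Num.Theory.
Import numFieldNormedType.Exports.

Set Implicit Arguments.
Unset Strict Implicit.
Unset Printing Implicit Defensive.

Local Open Scope classical_set_scope.
Local Open Scope ring_scope.

(* Subsets of {1, 2, ...} are encoded as sets of nat included in [posnat]. *)
Definition posnat : set nat := [set n | (0 < n)%N].

Definition progression (n : int) (s : nat) : set int :=
  [set n + s%:Z * z | z in [set: int]].

Definition multiples (B : set nat) : set int :=
  \bigcup_(b in B) progression 0 b.

Definition multiple_free (B : set nat) : set int := ~` multiples B.

Definition dilate (d : nat) (A : set nat) : set nat := [set (d * a)%N | a in A].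

Section Densities.
Variable R : realType.
Implicit Types A : set int.

Definition has_density A (l : R) : Prop :=
  (fun n : nat => (\sum_(1 <= k < n.+1 | k%:Z \in A) 1)%N%:R / n%:R : R) @ \oo
    --> l.

(* A junk value when the limit does not exist; it does exist for every set
   [multiples B] with B included in [posnat] (Davenport-Erdos). *)
Definition log_density A : R :=
  lim ((fun n : nat =>
    (ln n%:R)^-1 * \sum_(1 <= k < n.+1 | k%:Z \in A) (k%:R)^-1 : R) @ \oo).

Definition besicovitch (B : set nat) : Prop :=
  exists l : R, has_density (multiples B) l.

Definition taut (B : set nat) : Prop :=
  forall b, B b ->
    log_density (multiples (B `\ b)) < log_density (multiples B).

End Densities.

Definition primitive (B : set nat) : Prop :=
  forall b b', B b -> B b' -> (b %| b')%N -> b = b'.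

Definition prim (B : set nat) : set nat :=
  B `\` \bigcup_(k in [set k | (2 <= k)%N]) dilate k B.

Definition minimal (B : set nat) : Prop :=
  primitive B /\
  forall n : int, exists2 s : nat, posnat s &
    progression n s `<=` multiples B \/ progression n s `<=` multiple_free B.

Definition pairwise_coprime (A : set nat) : Prop :=
  forall a a', A a -> A a' -> a <> a' -> coprime a a'.

Definition coprime_divisors (B : set nat) : set nat :=
  [set d | posnat d /\ exists A : set nat,
     [/\ A `<=` posnat, infinite_set A, pairwise_coprime A &
         dilate d A `<=` B]].

Definition star (B : set nat) : set nat := prim (B `|` coprime_divisors B).

(* Main.v *)
Require Import Defs.
From mathcomp Require Import all_boot all_order all_algebra.
From mathcomp Require Import all_classical all_reals all_analysis.
From mathcomp Require Import zify ring lra.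
Import Order.TTheory GRing.Theory Num.Theory.
Import numFieldNormedType.Exports.

Local Open Scope classical_set_scope.
Local Open Scope ring_scope.

(* Let [t 0, t 1, ...] list the elements of S, each infinitely often, and put
   [B = {t n * p n}] where the primes [p n] grow so fast that [p n] exceeds
   [2 ^ n.+1 * t n] times the product of all earlier elements of [B].
   - The reciprocals of the elements of [B] are summable, so the multiples of
     [B], or of any subset of [B], are uniformly approximated by periodic sets
     and have a natural density, which is then also the logarithmic density.
   - [B] is primitive, and removing one element [b] from it loses a positive
     proportion of an arithmetic progression of multiples of [b].
   - Every [s] in [S] lies in [D(B)] because of the infinitely many [s * p n]
     in [B].  Conversely let [d] be in [D(B)], with [dA] included in [B].  If
     no element of [S] divided [d], the Toeplitz property would give a
     progression [d + sZ] free of multiples of [S]; but for [a] in [A] coprime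
     to [s] it contains a multiple of [da], which belongs to [B]. *)

(** * Counting functions and natural density *)

(** Written with the same sum as [has_density], so that the two agree by conversion. *)
Definition count_upto (P : pred nat) (n : nat) : nat :=
  \sum_(1 <= k < n.+1 | P k) 1.

Lemma count_upto0 (P : pred nat) : count_upto P 0 = 0%N.
Proof. by rewrite /count_upto big_geq. Qed.

Lemma count_uptoS (P : pred nat) (n : nat) :
  count_upto P n.+1 = (count_upto P n + P n.+1)%N.
Proof.
by rewrite /count_upto big_mkcond big_nat_recr //= -big_mkcond; case: (P n.+1).
Qed.

Lemma count_upto_le (P : pred nat) (n : nat) : (count_upto P n <= n)%N.
Proof.
elim: n => [|n IHn]; first by rewrite count_upto0.
by rewrite count_uptoS; case: (P _); lia.
Qed.

Lemma count_upto_cover (P Q T : pred nat) (n : nat) :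
  (forall k, P k -> Q k || T k) ->
  (count_upto P n <= count_upto Q n + count_upto T n)%N.
Proof.
move=> PQT; elim: n => [|n IHn]; first by rewrite !count_upto0.
rewrite !count_uptoS; move: (PQT n.+1).
by case: (P _); case: (Q _); case: (T _) => //=; lia.
Qed.

Lemma count_upto_sub (P Q : pred nat) (n : nat) :
  (forall k, P k -> Q k) -> (count_upto P n <= count_upto Q n)%N.
Proof.
move=> PQ; elim: n => [|n IHn]; first by rewrite !count_upto0.
rewrite !count_uptoS; move: (PQ n.+1).
by case: (P _); case: (Q _) => //=; lia.
Qed.

Lemma count_upto_disjoint (P Q T : pred nat) (n : nat) :
  (forall k, P k -> T k) -> (forall k, Q k -> T k) ->
  (forall k, P k -> ~~ Q k) ->
  (count_upto P n + count_upto Q n <= count_upto T n)%N.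
Proof.
move=> PT QT PQ; elim: n => [|n IHn]; first by rewrite !count_upto0.
rewrite !count_uptoS; move: (PT n.+1) (QT n.+1) (PQ n.+1).
by case: (P _); case: (Q _); case: (T _) => //=; lia.
Qed.

Lemma count_upto_dvdn (d n : nat) : count_upto (dvdn d) n = (n %/ d)%N.
Proof.
rewrite divn_count_dvd /count_upto big_mkcond /=.
by apply: eq_bigr => k _; case: (d %| k)%N.
Qed.

Lemma count_upto_periodic (P : pred nat) (q n : nat) :
  (forall k, P (k + q)%N = P k) ->
  count_upto P (n + q) = (count_upto P n + count_upto P q)%N.
Proof.
move=> per; elim: n => [|n IHn]; first by rewrite count_upto0.
by rewrite addSn !count_uptoS IHn -addSn per; lia.
Qed.

Lemma count_upto_periodicM (P : pred nat) (q m n : nat) :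
  (forall k, P (k + q)%N = P k) ->
  count_upto P (n + m * q) = (count_upto P n + m * count_upto P q)%N.
Proof.
move=> per; elim: m => [|m IHm]; first by rewrite !mul0n !addn0.
by rewrite mulSn addnCA addnC count_upto_periodic // IHm; lia.
Qed.

Lemma count_upto_bigcup_dvdn (c : nat -> nat) (K M n : nat) :
  (count_upto (fun x => [exists j : 'I_M, (K <= j)%N && (c j %| x)%N]) n
   <= \sum_(K <= j < M) n %/ c j)%N.
Proof.
elim: M => [|M IHM].
  rewrite big_geq // leqn0; apply/eqP/big1 => x /existsP[[]] //.
have [KM|MK] := leqP K M; last first.
  rewrite big_geq //.
  rewrite leqn0; apply/eqP/big1 => x /existsP[[j jM]] /=.
  by move=> /andP[Kj _]; lia.
rewrite big_nat_recr //= -count_upto_dvdn.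
apply: leq_trans (leq_add IHM (leqnn _)).
apply: count_upto_cover => x /existsP[[j jM]] /= /andP[Kj cx].
have [jltM|Mj] := ltnP j M.
  by apply/orP; left; apply/existsP; exists (Ordinal jltM); rewrite /= Kj.
have -> : M = j by lia.
by rewrite cx orbT.
Qed.

Lemma count_upto_gt0 (P : pred nat) (k n : nat) :
  (0 < k <= n)%N -> P k -> (0 < count_upto P n)%N.
Proof.
move=> /andP[k0 kn] Pk; elim: n kn => [|n IHn]; first by lia.
rewrite count_uptoS leq_eqVlt => /predU1P[<-|/IHn]; last by lia.
by rewrite Pk addn1.
Qed.

(** * Existence of natural densities *)

Section Limits.
Variable R : realType.

Lemma sum_geometric_half_le (K M : nat) :
  \sum_(K <= j < M) ((2 ^ j.+1)%N%:R)^-1 <= ((2 ^ K)%N%:R)^-1 :> R.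
Proof.
have [MK|KM] := leqP M K; first by rewrite big_geq // invr_ge0.
suff -> : \sum_(K <= j < M) ((2 ^ j.+1)%N%:R)^-1
    = ((2 ^ K)%N%:R)^-1 - ((2 ^ M)%N%:R)^-1 :> R.
  by rewrite lerBlDr lerDl invr_ge0.
rewrite -[RHS]opprB -(telescope_sumr (fun j => ((2 ^ j)%N%:R)^-1) (ltnW KM)).
rewrite -sumrN; apply: eq_bigr => j _.
rewrite opprB expnS natrM.
have : (2 ^ j)%N%:R != 0 :> R by rewrite pnatr_eq0 -lt0n expn_gt0.
by move=> h; field.
Qed.

(** Union bound: up to [n] there are at most [n / c j] multiples of [c j], and the sum of [2^-(j+1)]
    over [j >= K] is [2^-K]. The factor [D] serves tautness, where the tail must be small against a
    residue class modulo [D]. *)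
Lemma count_upto_multiples_le (c : nat -> nat) (D K n : nat) (P : pred nat) :
  (0 < D)%N -> (forall j, (K <= j)%N -> (D * 2 ^ j.+1 <= c j)%N) ->
  (forall x, (0 < x)%N -> P x -> exists2 j, (K <= j)%N & (c j %| x)%N) ->
  (count_upto P n)%:R <= n%:R / (D * 2 ^ K)%N%:R :> R.
Proof.
move=> D0 cD Pc.
have le1 : (count_upto P n <= \sum_(K <= j < n) n %/ c j)%N.
  apply: leq_trans (count_upto_bigcup_dvdn c K n n).
  rewrite /count_upto [leqLHS]big_mkcond [leqRHS]big_mkcond /=.
  rewrite big_nat [leqRHS]big_nat; apply: leq_sum => x /andP[x0 xn].
  case: ifPn => // Px; have [j Kj cx] := Pc _ x0 Px.
  have cjx := dvdn_leq x0 cx.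
  (* [j < 2 ^ j.+1 <= c j <= x <= n], so the indices below [n] suffice. *)
  have jn : (j < n)%N.
    have := cD _ Kj; have : (j.+1 < 2 ^ j.+1)%N by rewrite ltn_expl.
    have : (2 ^ j.+1 <= D * 2 ^ j.+1)%N by rewrite leq_pmull.
    lia.
  by rewrite ifT //; apply/existsP; exists (Ordinal jn); rewrite /= Kj.
have {}le1 : (count_upto P n)%:R <= \sum_(K <= j < n) n%:R / (c j)%:R :> R.
  apply: le_trans (_ : (\sum_(K <= j < n) n %/ c j)%N%:R <= _).
    by rewrite ler_nat.
  rewrite natr_sum big_nat [leRHS]big_nat; apply: ler_sum => j /andP[Kj _].
  have c0 : (0 < c j)%N.
    by apply: leq_trans (cD _ Kj); rewrite muln_gt0 D0 expn_gt0.
  by rewrite ler_pdivlMr ?ltr0n // -natrM ler_nat leq_divM.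
apply: (le_trans le1); rewrite -mulr_sumr ler_wpM2l //.
apply: le_trans (_ : \sum_(K <= j < n) D%:R^-1 * ((2 ^ j.+1)%N%:R)^-1 <= _).
  rewrite big_nat [leRHS]big_nat; apply: ler_sum => j /andP[Kj _].
  rewrite -invfM -natrM lef_pV2 ?posrE ?ltr0n ?ler_nat; first exact: cD.
    by apply: leq_trans (cD _ Kj); rewrite muln_gt0 D0 expn_gt0.
  by rewrite muln_gt0 D0 expn_gt0.
rewrite -mulr_sumr natrM invfM ler_wpM2l ?invr_ge0 //.
exact: sum_geometric_half_le.
Qed.

Lemma cvg_inv_natr : (n%:R : R)^-1 @[n --> \oo] --> 0.
Proof. rewrite -cvg_shiftS; exact: cvg_harmonic. Qed.

Lemma cvg_div_natr (u : nat -> R) (a C : R) :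
  (forall n, `|u n - a * n%:R| <= C) -> u n / n%:R @[n --> \oo] --> a.
Proof.
move=> uC; apply/cvgrPdist_le => e e0.
have C0 : C * n%:R^-1 @[n --> \oo] --> (0 : R).
  by rewrite -(mulr0 C); apply: cvgM; [exact: cvg_cst|exact: cvg_inv_natr].
move/cvgrPdist_le : C0 => /(_ e e0) C0.
near=> n.
have n0 : 0 < n%:R :> R by rewrite ltr0n; near: n; exists 1%N.
have -> : a - u n / n%:R = - (u n - a * n%:R) / n%:R.
  by have := lt0r_neq0 n0 => ?; field.
rewrite normrM normrN normfV (ger0_norm (ltW n0)).
apply: le_trans (_ : `|0 - C / n%:R| <= _); last by near: n.
rewrite sub0r normrN normrM normfV (ger0_norm (ltW n0)) ler_wpM2r ?invr_ge0 //.
exact: le_trans (ler_norm _).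
Unshelve. all: by end_near. Qed.

(** Full periods contribute exact proportions; the incomplete one leaves a bounded error, which
    disappears after division by [n]. *)
Lemma periodic_has_density (P : pred nat) (q : nat) :
  (0 < q)%N -> (forall k, P (k + q)%N = P k) ->
  ((count_upto P n)%:R / n%:R : R) @[n --> \oo] -->
    ((count_upto P q)%:R / q%:R : R).
Proof.
move=> q0 per; apply: (@cvg_div_natr _ _ (q%:R + q%:R)) => n.
set c := count_upto P q; set s := count_upto P (n %% q)%N.
have -> : count_upto P n = (s + n %/ q * c)%N.
  by rewrite {1}(divn_eq n q) addnC count_upto_periodicM.
have nE : n%:R = (n %/ q)%N%:R * q%:R + (n %% q)%N%:R :> R.
  by rewrite {1}(divn_eq n q) natrD natrM.
have q0R : q%:R != 0 :> R by rewrite pnatr_eq0 -lt0n.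
have -> : (s + n %/ q * c)%N%:R - c%:R / q%:R * n%:R
    = s%:R - c%:R / q%:R * (n %% q)%N%:R :> R.
  by rewrite nE natrD natrM; field.
apply: le_trans (ler_normB _ _) _; apply: lerD.
  rewrite ger0_norm // ler_nat.
  by apply: leq_trans (count_upto_le _ _) _; rewrite ltnW // ltn_mod.
rewrite ger0_norm ?mulr_ge0 ?invr_ge0 //.
have cq : c%:R / q%:R <= 1 :> R.
  by rewrite ler_pdivrMr ?ltr0n // mul1r ler_nat count_upto_le.
have rq : (n %% q)%N%:R <= q%:R :> R by rewrite ler_nat ltnW // ltn_mod.
by rewrite -[leRHS]mul1r; apply: ler_pM => //; rewrite mulr_ge0 ?invr_ge0.
Qed.

(** By completeness: eventually [f] is within [2e/3] of the limit of [g], so [f] is Cauchy and no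
    candidate limit has to be named. *)
Lemma cvgn_uniform_approx (f : nat -> R) :
  (forall e : R, 0 < e -> exists2 g : nat -> R,
     cvgn g & forall n, `|f n - g n| <= e) -> cvgn f.
Proof.
move=> fg; apply/cauchy_cvgP/cauchy_exP => e e0.
have [g g_cvg fge] := fg (e / 3) (divr_gt0 e0 (ltr0Sn R 2)).
have : g @ \oo --> limn g by [].
move=> /cvgrPdist_le /(_ (e / 3) (divr_gt0 e0 (ltr0Sn R 2))) [N _ gN].
exists (limn g); exists N => // n /= Nn; rewrite /ball /=.
have := gN n Nn; have := fge n; rewrite /= (distrC (f n)).
move=> h1 h2; have := ler_distD (g n) (limn g) (f n).
by move: h1 h2; lra.
Qed.

(** Keeping only the indices [j < K] gives a set periodic modulo the product of these [c j], with
    error at most [2^-K] uniformly in [n]. A general [J] covers both the whole family and the family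
    without one element. *)
Lemma geometric_multiples_has_density (c : nat -> nat) (J : set nat) :
  (forall j, (2 ^ j.+1 <= c j)%N) ->
  cvgn (fun n =>
    (count_upto (fun x => `[< exists2 j, J j & (c j %| x)%N >]) n)%:R
      / n%:R : R).
Proof.
move=> c2; pose P x := `[< exists2 j, J j & (c j %| x)%N >].
have c0 j : (0 < c j)%N by apply: leq_trans (c2 j); rewrite expn_gt0.
apply: cvgn_uniform_approx => e e0.
have [K Ke] : exists K, ((2 ^ K)%N%:R)^-1 <= e.
  have := cvg_inv_natr => /cvgrPdist_le /(_ e e0) [N _ /(_ N.+1 (leqnSn N))].
  rewrite /= sub0r normrN ger0_norm ?invr_ge0 // => Ne; exists N.+1.
  apply: le_trans Ne; rewrite lef_pV2 ?posrE ?ltr0n ?expn_gt0 // ler_nat.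
  by rewrite ltnW // ltn_expl.
pose PK x := `[< exists j, [/\ J j, (j < K)%N & (c j %| x)%N] >].
exists (fun n => (count_upto PK n)%:R / n%:R).
  pose q := (\prod_(j < K) c j)%N.
  have cq j : (j < K)%N -> (c j %| q)%N.
    by move=> jK; rewrite /q (bigD1 (Ordinal jK)) //= dvdn_mulr.
  apply/cvg_ex; exists ((count_upto PK q)%:R / q%:R).
  apply: periodic_has_density.
    by rewrite /q; apply: prodn_gt0 => i.
  move=> k; apply/asbool_equiv_eq.
  split=> -[j [Jj jK cjk]]; exists j; split=> //.
    by rewrite -(dvdn_addl _ (cq j jK)).
  by rewrite dvdn_addl // cq.
move=> n.
rewrite -/P; have [->|n0] := posnP n.
  by rewrite invr0 !mulr0 subrr normr0 ltW.
have le1 : (count_upto PK n <= count_upto P n)%N.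
  apply: count_upto_sub => x /asboolP[j [Jj jK cjx]].
  by apply/asboolP; exists j.
pose T x := `[< exists2 j, (K <= j)%N & (c j %| x)%N >].
have le2 : (count_upto P n <= count_upto PK n + count_upto T n)%N.
  apply: count_upto_cover => x /asboolP[j Jj cjx].
  have [jK|Kj] := ltnP j K.
    by apply/orP; left; apply/asboolP; exists j; split.
  by apply/orP; right; apply/asboolP; exists j.
have le3 : (count_upto T n)%:R <= n%:R / (1 * 2 ^ K)%N%:R :> R.
  apply: (@count_upto_multiples_le c) => //.
    by move=> j _; rewrite mul1n.
  by move=> x _ /asboolP.
rewrite -mulrBl normrM normfV [`|n%:R|]ger0_norm // ler_pdivrMr ?ltr0n //.
rewrite ger0_norm ?subr_ge0 ?ler_nat //.
move: le2; rewrite -(ler_nat R) natrD mul1n in le3 *.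
have := ler_wpM2l (ler0n R n) Ke; rewrite mulrC [_ * e]mulrC.
rewrite (mulrC _ (_^-1)) in le3; lra.
Qed.

End Limits.

(** * Logarithmic density *)

Section LogLimits.
Variable R : realType.

(** Both bounds are [ln (1 + x) <= x], at [x = -1/(n+2)] and at [x = 1/(n+1)]. *)
Lemma ln_natrS_bounds (n : nat) :
  (n.+2%:R : R)^-1 <= ln (n.+2%:R : R) - ln n.+1%:R <= (n.+1%:R)^-1.
Proof.
have a0 : 0 < n.+1%:R :> R by rewrite ltr0n.
have b0 : 0 < n.+2%:R :> R by rewrite ltr0n.
have ba : n.+2%:R = n.+1%:R + 1 :> R by rewrite -natr1.
have ia : 0 < (n.+1%:R : R)^-1 by rewrite invr_gt0.
have ib : (n.+2%:R : R)^-1 < 1 by rewrite invf_lt1 // ba ltrDr.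
rewrite -ln_div ?posrE //; apply/andP; split.
  rewrite -[leRHS]opprK lerNr -lnV ?posrE ?divr_gt0 // invf_div.
  have -> : n.+1%:R / n.+2%:R = 1 + - (n.+2%:R)^-1 :> R.
    by move: a0; rewrite ba => a0; field; apply: lt0r_neq0; lra.
  by apply: le_ln1Dx; rewrite ltrN2.
have -> : n.+2%:R / n.+1%:R = 1 + (n.+1%:R)^-1 :> R.
  by rewrite ba; field; exact: lt0r_neq0.
by apply: le_ln1Dx; rewrite (lt_trans _ ia) // ltrN10.
Qed.

Lemma harmonic_sum_ln_bounds (n : nat) :
  ln (n%:R : R) <= \sum_(0 <= k < n) (k.+1%:R : R)^-1 <= 1 + ln (n%:R : R).
Proof.
case: n => [|n]; first by rewrite big_geq // ln0 // addr0 lexx ler01.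
elim: n => [|n /andP[IH1 IH2]].
  by rewrite big_nat1 ln1 invr1 addr0 lexx ler01.
rewrite big_nat_recr //=; have /andP[h1 h2] := ln_natrS_bounds n.
apply/andP; split; last by apply: le_trans (lerD IH2 h1) _; lra.
(* The plain lower bound is not inductive: the sum gains [1/(n+2)], while [ln] is only known to gain
   at most [1/(n+1)]. The surplus [1/(n+1)] repairs this. *)
suff : ln (n.+1%:R : R) + (n.+1%:R)^-1 <= \sum_(0 <= k < n.+1) (k.+1%:R : R)^-1.
  rewrite lerBlDl in h2; move=> /(le_trans h2) /le_trans; apply.
  by rewrite lerDl invr_ge0.
elim: n {IH1 IH2 h1 h2} => [|n IHn]; first by rewrite big_nat1 ln1 add0r.
rewrite big_nat_recr //= lerD2r.
by apply: le_trans IHn; rewrite -lerBlDl; have /andP[] := ln_natrS_bounds n.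
Qed.

Lemma cvg_inv_ln_natr : (ln (n%:R : R))^-1 @[n --> \oo] --> 0.
Proof.
apply/cvgrPdist_le => e e0.
exists (Num.truncn (expR e^-1)).+1 => // n /= Nn.
have en : expR e^-1 < n%:R.
  by apply: lt_le_trans (Num.Theory.truncnS_gt _) _; rewrite ler_nat.
have n0 : 0 < n%:R :> R by apply: lt_trans en; rewrite expR_gt0.
have lne : e^-1 < ln n%:R by rewrite -ltr_expR lnK ?posrE.
have ln0 : 0 < ln (n%:R : R) by apply: lt_trans lne; rewrite invr_gt0.
rewrite sub0r normrN ger0_norm ?invr_ge0 ?(ltW ln0) //.
by rewrite -[leRHS]invrK lef_pV2 ?posrE ?invr_gt0 // ltW.
Qed.

(** The weights [1/(k+1)] sum to [ln n] up to a bounded error, which settles the constant part [l].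
    In the deviations [v k - l], the terms below some [K] have a bounded sum and the others are
    uniformly small. *)
Lemma log_cesaro (v : nat -> R) (l : R) :
  v @ \oo --> l ->
  (ln n%:R)^-1 * \sum_(0 <= k < n) v k / k.+1%:R @[n --> \oo] --> l.
Proof.
move=> vl.
have ln_gt0 n : (1 < n)%N -> 0 < ln (n%:R : R).
  by move=> n1; rewrite ln_gt0 // ltr1n.
have h1 : (ln n%:R)^-1 * \sum_(0 <= k < n) (k.+1%:R : R)^-1 @[n --> \oo]
    --> (1 : R).
  apply/cvgrPdist_le => e e0.
  have /cvgrPdist_le /(_ e e0) small := cvg_inv_ln_natr.
  near=> n.
  have L0 : 0 < ln (n%:R : R) by apply: ln_gt0; near: n; exists 2%N.
  have /andP[b1 b2] := harmonic_sum_ln_bounds n.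
  have : `|0 - (ln (n%:R : R))^-1| <= e by near: n.
  rewrite sub0r normrN ger0_norm ?invr_ge0 ?(ltW L0) // => Le.
  rewrite distrC ger0_norm ?subr_ge0.
    apply: le_trans Le; rewrite lerBlDr -(ler_pM2l L0) mulrA mulrDr.
    by rewrite divff ?lt0r_neq0 // mul1r mulr1.
  by rewrite -(ler_pM2l L0) mulrA divff ?lt0r_neq0 // mul1r mulr1.
suff h0 : (ln n%:R)^-1 * \sum_(0 <= k < n) (v k - l) / k.+1%:R @[n --> \oo]
    --> (0 : R).
  rewrite -[l]add0r -[in X in _ --> X](mulr1 l).
  have -> : (fun n => (ln n%:R)^-1 * \sum_(0 <= k < n) v k / k.+1%:R) =
      (fun n =>
      (ln n%:R)^-1 * (\sum_(0 <= k < n) (v k - l) / k.+1%:R)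
      + l * ((ln n%:R)^-1 * \sum_(0 <= k < n) (k.+1%:R)^-1)).
    apply/funext => n; rewrite mulrCA -mulrDr; congr (_ * _).
    rewrite mulr_sumr -big_split /=.
    by apply: eq_bigr => k _; rewrite -mulrDl subrK.
  by apply: cvgD => //; apply: cvgM => //; exact: cvg_cst.
apply/cvgrPdist_le => e e0.
have e2 : 0 < e / 2 by rewrite divr_gt0.
have e4 : 0 < e / 2 / 2 by rewrite divr_gt0.
have /cvgrPdist_le /(_ _ e4) [K _ vK] := vl.
set C := \sum_(0 <= k < K) `|v k - l| / k.+1%:R.
have head n : `|\sum_(0 <= k < n) (v k - l) / k.+1%:R|
    <= C + e / 2 / 2 * \sum_(0 <= k < n) (k.+1%:R : R)^-1.
  apply: le_trans (ler_norm_sum _ _ _) _.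
  under eq_bigr do rewrite normrM [`|_^-1|]ger0_norm ?invr_ge0 //.
  have C0 m : 0 <= \sum_(0 <= k < m) `|v k - l| / k.+1%:R.
    by apply: sumr_ge0 => k _; rewrite mulr_ge0 ?invr_ge0.
  elim: n => [|n IHn]; first by rewrite !big_geq // mulr0 addr0; exact: C0.
  have [nK|Kn] := ltnP n K.
    apply: le_trans (_ : C <= _).
      rewrite /C [leRHS](big_cat_nat (n := n.+1)) /= ?lerDl //.
      by apply: sumr_ge0 => k _; rewrite mulr_ge0 ?invr_ge0.
    rewrite lerDl mulr_ge0 ?(ltW e4) //.
    by apply: sumr_ge0 => k _; rewrite invr_ge0.
  rewrite !big_nat_recr //= mulrDr addrA lerD //.
  by rewrite ler_wpM2r ?invr_ge0 // distrC; exact: vK.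
(* The harmonic sum is at most [1 + ln n]; its [1] adds [e / 4] to the constant [C]. *)
have CL : (C + e / 2 / 2) * (ln (n%:R : R))^-1 @[n --> \oo] --> (0 : R).
  rewrite -(mulr0 (C + e / 2 / 2)).
  by apply: cvgM; [exact: cvg_cst|exact: cvg_inv_ln_natr].
move/cvgrPdist_le : CL => /(_ _ e2) small.
near=> n.
have L0 : 0 < ln (n%:R : R) by apply: ln_gt0; near: n; exists 2%N.
have : `|0 - (C + e / 2 / 2) * (ln (n%:R : R))^-1| <= e / 2 by near: n.
rewrite sub0r normrN => /(le_trans (ler_norm _)).
rewrite ler_pdivrMr // => Cle.
rewrite sub0r normrN normrM [`|_^-1|]ger0_norm ?invr_ge0 ?(ltW L0) //.
rewrite mulrC ler_pdivrMr //.
apply: (le_trans (head n)).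
have /andP[_ b2] := harmonic_sum_ln_bounds n.
have := ler_wpM2l (ltW e4) b2; have := mulr_gt0 e0 L0; move: Cle; lra.
Unshelve. all: by end_near. Qed.

(** Abel summation with [1/k - 1/(k+1) = 1/(k(k+1))], arranged so that density quotients appear with
    the weights of [log_cesaro]. The term [k = 0] is zero. *)
Lemma sum_inv_count_upto (P : pred nat) (n : nat) :
  \sum_(1 <= k < n.+1 | P k) (k%:R : R)^-1 =
    (count_upto P n)%:R / n%:R
    + \sum_(0 <= k < n) (count_upto P k)%:R / k%:R / k.+1%:R.
Proof.
elim: n => [|n IHn].
  by rewrite !big_geq // count_upto0 mul0r addr0.
rewrite big_mkcond big_nat_recr //= -big_mkcond /= IHn.
rewrite big_nat_recr //= count_uptoS natrD.
have n1 : n.+1%:R != 0 :> R by rewrite pnatr_eq0.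
have -> : (if P n.+1 then (n.+1%:R)^-1 else 0) = (P n.+1)%:R / n.+1%:R :> R.
  by case: (P _); rewrite ?mul1r ?mul0r.
have [->|n0] := posnP n; first by rewrite !big_geq // count_upto0 !mul0r; ring.
have {}n0 : n%:R != 0 :> R by rewrite pnatr_eq0 -lt0n.
by rewrite -natr1 in n1 *; field; rewrite ?n0 ?n1.
Qed.

(** After Abel summation the boundary term is a convergent quotient divided by [ln n], hence tends
    to 0; the rest is a logarithmic average of the density quotients. *)
Lemma has_density_log_density (A : set int) (l : R) :
  has_density A l -> log_density R A = l.
Proof.
move=> dA; apply: (cvg_lim (@Rhausdorff R)).
under eq_fun do rewrite (sum_inv_count_upto (fun k => k%:Z \in A)) mulrDr.
rewrite -[l]add0r; apply: cvgD; last exact: log_cesaro.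
by rewrite -(mul0r l); apply: cvgM => //; exact: cvg_inv_ln_natr.
Qed.

End LogLimits.

(** * The construction *)

Lemma multiplesP (B : set nat) (x : int) :
  multiples B x <-> exists2 b, B b & (b %| `|x|)%N.
Proof.
split=> [[b Bb [z _ <-]]|[b Bb bx]].
  by exists b => //; rewrite add0r abszM dvdn_mulr.
exists b => //; have /dvdzP[z zE] : (b %| x)%Z by rewrite dvdzE.
by exists z => //; rewrite add0r mulrC.
Qed.

Lemma infinite_unbounded (A : set nat) :
  (forall N, exists2 x, A x & (N <= x)%N) -> infinite_set A.
Proof.
move=> unb /finite_seqP[s As].
have [x] := unb (\max_(y <- s) y).+1; rewrite As /= => xs.
by rewrite ltnNge (@leq_bigmax_seq _ _ xpredT id).
Qed.

(** Otherwise send each [a] in [A] to the least prime factor of [gcdn a s]. Pairwise coprimality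
    makes this injective, and its values are at most [s], so [A] would be finite. *)
Lemma infinite_pairwise_coprime_coprime (A : set nat) (s : nat) :
  (0 < s)%N -> infinite_set A -> pairwise_coprime A ->
  exists2 a, A a & coprime a s.
Proof.
move=> s0 infA cpA; apply: contrapT => noA; apply: infA.
pose f a := pdiv (gcdn a s).
have nc a : A a -> (1 < gcdn a s)%N.
  move=> Aa; rewrite ltn_neqAle gcdn_gt0 s0 orbT andbT eq_sym.
  by apply/negP => cas; apply: noA; exists a.
have f_inj : {in A &, injective f}.
  move=> a a' /set_mem Aa /set_mem Aa' faa'.
  apply: contrapT => /(cpA _ _ Aa Aa').
  move=> /eqP cop; have := pdiv_dvd (gcdn a' s).
  have := pdiv_dvd (gcdn a s); rewrite -/(f a) -/(f a') -faa' !dvdn_gcd.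
  move=> /andP[fa _] /andP[fa' _].
  have : (f a %| gcdn a a')%N by rewrite dvdn_gcd fa.
  by rewrite cop dvdn1 /f => /eqP e; have := pdiv_prime (nc _ Aa); rewrite e.
rewrite -(eq_finite_set (inj_card_eq f_inj)).
apply: (@sub_finite_set _ _ `I_s.+1); last exact: finite_II.
move=> _ [a Aa <-] /=; rewrite ltnS; apply: dvdn_leq => //.
by apply: dvdn_trans (pdiv_dvd _) _; exact: dvdn_gcdr.
Qed.

Lemma exists_recurrent_enumeration (S : set nat) (s0 : nat) : S s0 ->
  exists t : nat -> nat, (forall n, S (t n)) /\
    forall s, S s -> forall N, exists2 n, (N <= n)%N & t n = s.
Proof.
move=> Ss0.
(* The 2-adic valuation of [n.+1] takes every value infinitely often; values outside [S] are
   replaced by [s0]. *)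
exists (fun n => if `[< S (logn 2 n.+1) >] then logn 2 n.+1 else s0).
split=> [n|s Ss N]; first by case: asboolP.
(* The index [2 ^ s * 3 ^ N - 1] has valuation [s], and it is at least [N] because [3 ^ N > N]. *)
have e : ((2 ^ s * 3 ^ N).-1.+1 = 3 ^ N * 2 ^ s)%N.
  by rewrite prednK ?muln_gt0 ?expn_gt0 // mulnC.
have l : logn 2 (2 ^ s * 3 ^ N).-1.+1 = s.
  by rewrite e logn_Gauss ?pfactorK // coprimeXr.
exists (2 ^ s * 3 ^ N).-1; last by rewrite l asboolT.
rewrite -ltnS e; apply: leq_trans (leq_pmulr _ _); last by rewrite expn_gt0.
by rewrite ltn_expl.
Qed.

Lemma exists_sparse_primes (t : nat -> nat) :
  exists p : nat -> nat, forall n, prime (p n) /\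
    (2 ^ n.+1 * \prod_(i < n) (t i * p i) * t n < p n)%N.
Proof.
pose next n q := s2val (prime_above (2 ^ n.+1 * q * t n)).
(* Recursion on the running product replaces a recursion on all earlier primes. *)
pose fix q n := if n is m.+1 then (q m * (t m * next m (q m)))%N else 1%N.
have qE n : q n = (\prod_(i < n) (t i * next i (q i)))%N.
  by elim: n => [|n IHn]; rewrite ?big_ord0 // big_ord_recr /= IHn.
exists (fun n => next n (q n)) => n; rewrite -qE /next.
by case: prime_above.
Qed.

Lemma coprime_divisors_minimal (S B : set nat) (d : nat) :
  S `<=` posnat -> minimal S ->
  (forall b, B b -> exists2 s, S s & (s %| b)%N) ->
  coprime_divisors B d -> exists2 s, S s & (s %| d)%N.
Proof.
move=> S_pos [_ S_toeplitz] BS [d0 [A [A_pos A_inf A_cop dAB]]].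
have [s s0 [sub|sub]] := S_toeplitz d%:Z.
  suff /sub/multiplesP : progression d%:Z s d%:Z by [].
  by exists 0 => //; rewrite mulr0 addr0.
have [a Aa a_s] := infinite_pairwise_coprime_coprime A s s0 A_inf A_cop.
have [s' Ss' s'da] := BS (d * a)%N (dAB _ (ex_intro2 _ _ a Aa erefl)).
(* From [u * a + v * s = 1], the multiple [d * a * u] of [d * a] equals [d - s * (d * v)], so it
   lies in the progression. *)
have /coprimezP[[u v] /= uv] : coprimez a s by [].
have /sub[] : progression d%:Z s (d%:Z * a%:Z * u).
  exists (- (d%:Z * v)) => //.
  by rewrite -[X in X + _]mulr1 -uv; ring.
apply/multiplesP; exists s' => //.
by rewrite abszM dvdn_mulr // abszM.
Qed.

(** * The sparse set [range b] and its image under [star] *)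

Section Construction.
Variables (S : set nat) (t p : nat -> nat).
Hypothesis S_pos : S `<=` posnat.
Hypothesis S_prim : primitive S.
Hypothesis tS : forall n, S (t n).
Hypothesis t_rec : forall s, S s -> forall N, exists2 n, (N <= n)%N & t n = s.
Hypothesis p_prime : forall n, prime (p n).
Hypothesis p_big : forall n,
  (2 ^ n.+1 * \prod_(i < n) (t i * p i) * t n < p n)%N.

Let b (n : nat) : nat := (t n * p n)%N.
Let q (n : nat) : nat := (\prod_(i < n) b i)%N.

Lemma b_gt0 n : (0 < b n)%N.
Proof. by rewrite muln_gt0 (S_pos _ (tS n)) prime_gt0. Qed.

Lemma q_gt0 n : (0 < q n)%N.
Proof. by apply: prodn_gt0 => i; exact: b_gt0. Qed.

Lemma b_dvd_q i n : (i < n)%N -> (b i %| q n)%N.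
Proof. by move=> i_n; rewrite /q (bigD1 (Ordinal i_n)) //= dvdn_mulr. Qed.

Lemma leq_q m n : (m <= n)%N -> (q m <= q n)%N.
Proof.
move=> mn; rewrite -(subnKC mn) /q big_split_ord /=.
by rewrite leq_pmulr // prodn_gt0 // => i; exact: b_gt0.
Qed.

Lemma p_gt n : (2 ^ n.+1 * q n <= p n)%N.
Proof.
by apply: leq_trans (ltnW (p_big n)); rewrite leq_pmulr //; apply: S_pos.
Qed.

Lemma b_ge n : (2 ^ n.+1 <= b n)%N.
Proof.
apply: leq_trans (_ : p n <= _)%N; last by rewrite leq_pmull //; apply: S_pos.
by apply: leq_trans (p_gt n); rewrite leq_pmulr // q_gt0.
Qed.

Lemma p_Ndvd_qt n : ~~ (p n %| q n * t n)%N.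
Proof.
rewrite gtnNdvd // ?muln_gt0 ?q_gt0 //=; first exact: S_pos.
apply: leq_ltn_trans (p_big n).
by rewrite -mulnA leq_pmull // expn_gt0.
Qed.

Lemma p_Ndvd_b i n : (i < n)%N -> ~~ (p n %| b i)%N.
Proof.
move=> i_n; apply: contra (p_Ndvd_qt n) => pb.
by rewrite dvdn_mulr // (dvdn_trans pb) // b_dvd_q.
Qed.

(** If [k < i], the prime [p i] divides [b i] but not [b k]. If [i < k], [p k] is coprime to [b i],
    so [b i] divides [t k]; primitivity of [S] gives [t i = t k], and [t i * p i] is too large to
    divide it. *)
Lemma b_antichain i k : (b i %| b k)%N -> i = k.
Proof.
move=> bik; have [ik|ki|//] := ltngtP i k; last first.
  by case/negP: (p_Ndvd_b _ _ ki); apply: dvdn_trans bik; rewrite dvdn_mull.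
have cop : coprime (b i) (p k).
  by rewrite coprime_sym prime_coprime // p_Ndvd_b.
have btk : (b i %| t k)%N by rewrite -(Gauss_dvdl _ cop).
have tik : t i = t k.
  by apply: S_prim => //; apply: dvdn_trans btk; rewrite dvdn_mulr.
have := dvdn_leq (S_pos _ (tS k)) btk.
rewrite -tik /b -[leqRHS]muln1 leq_pmul2l; last exact: S_pos.
by rewrite leqNgt prime_gt1.
Qed.

Lemma b_inj : injective b.
Proof. by move=> i k bik; apply: b_antichain; rewrite bik. Qed.

(** [S] lies in [D(B)], and every element of the union of [B] and [D(B)] has a divisor in [S]; as
    [S] is primitive, it consists of the minimal elements of that union for divisibility. *)
Lemma star_construction : minimal S -> star (range b) = S.
Proof.
move=> S_min.
have bS x : range b x -> exists2 s, S s & (s %| x)%N.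
  by move=> [n _ <-]; exists (t n) => //; rewrite dvdn_mulr.
have SD s : S s -> coprime_divisors (range b) s.
  move=> Ss; split; first exact: S_pos.
  exists [set p n | n in [set n | t n = s]]; split.
  - by move=> _ [n _ <-]; apply: prime_gt0.
  - apply: infinite_unbounded => N; have [n Nn tn] := t_rec _ Ss N.
    exists (p n); first by exists n.
    apply: leq_trans (p_gt n); apply: leq_trans Nn _.
    apply: leq_trans (leq_pmulr _ (q_gt0 n)).
    by apply: ltnW; apply: leq_trans (ltnW (ltn_expl _ _)).
  - move=> _ _ [n _ <-] [m _ <-] pnm.
    rewrite prime_coprime // dvdn_prime2 //; exact/eqP.
  - move=> _ [_ [n <- <-] <-]; exists n => //.
have US x : (range b `|` coprime_divisors (range b)) x ->
    (0 < x)%N /\ exists2 s, S s & (s %| x)%N.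
  move=> [Bx|Dx].
    by split; [case: Bx => n _ <-; exact: b_gt0|exact: bS].
  by split; [case: Dx|exact: (coprime_divisors_minimal S (range b))].
apply/seteqP; split=> [x [/US[x0 [s Ss /dvdnP[k xE]]] nx]|s Ss].
  suff k1 : k = 1%N by rewrite xE k1 mul1n.
  have k0 : (0 < k)%N by move: x0; rewrite xE muln_gt0 => /andP[].
  apply/eqP; rewrite eqn_leq k0 andbT leqNgt; apply/negP => k2.
  by apply: nx; exists k => //; exists s => //; right; exact: SD.
split; first by right; exact: SD.
(* If [s = k * y] with [y] in the union, a divisor [s'] of [y] in [S] also divides [s], so
   [s' = s <= y], against [k >= 2]. *)
move=> [k /= k2 [y /US[y0 [s' Ss' s'y]] sE]].
have s's : s' = s by apply: S_prim => //; rewrite -sE dvdn_mull.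
have := dvdn_leq y0 s'y; rewrite s's -sE; nia.
Qed.

(** * Densities and tautness of the sparse set *)

Variable R : realType.

Lemma subfamily_has_density (J : set nat) :
  exists l : R, has_density (multiples (b @` J)) l.
Proof.
have /cvg_ex[l lP] := geometric_multiples_has_density R b J b_ge.
have bE x :
    (x%:Z \in multiples (b @` J)) = `[< exists2 j, J j & (b j %| x)%N >].
  apply/idP/asboolP.
    by move/set_mem/multiplesP => [_ [j Jj <-] bx]; exists j.
  move=> [j Jj bx]; apply/mem_set/multiplesP; exists (b j) => //.
exists l; rewrite /has_density.
under eq_fun do under eq_bigl do rewrite bE.
exact: lP.
Qed.

Lemma range_bD1 k : range b `\ b k = b @` [set i | i != k].
Proof.
apply/seteqP; split=> [_ [[i _ <-] /= bik]|_ [i /= ik <-]].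
  by exists i => //=; apply: contra_notN bik => /eqP ->.
by split; [exists i|move=> /= /b_inj /eqP; apply/negP].
Qed.

(* The numbers congruent to [b k] modulo [b k * q k.+1] are multiples of [b k]
   and, by the antichain property, of no [b i] with [i < k]; those divisible
   by [b i] with [i > k] are multiples of [b k * p i], and are few since
   [p i] is large. *)
Lemma density_ltn k (l l' : R) :
  has_density (multiples (range b)) l ->
  has_density (multiples (range b `\ b k)) l' -> l' < l.
Proof.
rewrite range_bD1 => dl dl'.
pose M x := x%:Z \in multiples (range b).
pose M' x := x%:Z \in multiples (b @` [set i | i != k]).
pose D := (b k * q k.+1)%N.
have D0 : (0 < D)%N by rewrite muln_gt0 b_gt0 q_gt0.
pose W (x : nat) := (x == b k %[mod D])%N.
pose U (x : nat) := `[< exists2 j, (k < j)%N & (b k * p j %| x)%N >].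
have bkD : (b k %| D)%N by rewrite dvdn_mulr.
have Wk x : W x -> (b k %| x)%N.
  move=> /eqP Wx; rewrite /dvdn -(modn_dvdm x bkD) Wx modn_dvdm //.
  by rewrite modnn.
(* The class [W] without the exceptional set [U] lies in [M] and is disjoint from [M']. *)
have cnt n : (count_upto M' n + count_upto W n
    <= count_upto M n + count_upto U n)%N.
  pose V x := W x && ~~ U x.
  have h1 : (count_upto W n <= count_upto V n + count_upto U n)%N.
    by apply: count_upto_cover => x Wx; rewrite /V Wx /=; case: (U x).
  have h2 : (count_upto M' n + count_upto V n <= count_upto M n)%N.
    apply: count_upto_disjoint => [x|x|x].
    - move/set_mem/multiplesP => [_ [i _ <-] bx].
      by apply/mem_set/multiplesP; exists (b i) => //; exists i.
    - move=> /andP[/Wk bx _].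
      by apply/mem_set/multiplesP; exists (b k) => //; exists k.
    - move/set_mem/multiplesP => [_ [i /= ik <-] bx]; apply/negP => /andP[Wx].
      have [ki|i_le_k] := ltnP k i; last first.
        have biD : (b i %| D)%N by rewrite dvdn_mull // b_dvd_q.
        move: bx; rewrite /= /dvdn -(modn_dvdm x biD) (eqP Wx) modn_dvdm //.
        by move=> /b_antichain ik_eq; case/eqP: ik.
      move/asboolP; apply; exists i => //.
      rewrite Gauss_dvd ?Wk //=; last first.
        by rewrite coprime_sym prime_coprime // p_Ndvd_b.
      by apply: dvdn_trans bx; rewrite dvdn_mull.
  by lia.
have U_le n : (count_upto U n)%:R / n%:R <= ((D * 2 ^ k.+1)%N%:R)^-1 :> R.
  have [->|n0] := posnP n; first by rewrite invr0 mulr0 invr_ge0.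
  rewrite ler_pdivrMr ?ltr0n // mulrC.
  apply: (count_upto_multiples_le R (fun j => b k * p j)%N) => //.
    (* [p j] is at least [2 ^ j.+1 * q j], and [q k.+1 <= q j] since [k < j]. *)
    move=> j kj; rewrite /D -mulnA leq_pmul2l ?b_gt0 //.
    by apply: leq_trans (p_gt j); rewrite mulnC leq_pmul2l ?expn_gt0 // leq_q.
  by move=> x _ /asboolP.
have W_dens : ((count_upto W n)%:R / n%:R : R) @[n --> \oo] -->
    ((count_upto W D)%:R / D%:R : R).
  by apply: periodic_has_density => // x; rewrite /W modnDr.
have W_gt0 : (0 < count_upto W D)%N.
  apply: (@count_upto_gt0 _ (b k)); last exact: eqxx.
  by rewrite b_gt0 leq_pmulr // q_gt0.
have : l' + (count_upto W D)%:R / D%:R <= l + ((D * 2 ^ k.+1)%N%:R)^-1.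
  apply: (ler_cvg_to (cvgD dl' W_dens) (cvgD dl (cvg_cst _))).
  apply: nearW => n.
  change ((count_upto M' n)%:R / n%:R + (count_upto W n)%:R / n%:R
    <= (count_upto M n)%:R / n%:R + ((D * 2 ^ k.+1)%N%:R)^-1 :> R).
  rewrite -mulrDl -natrD.
  apply: le_trans (_ : (count_upto M n + count_upto U n)%N%:R / n%:R <= _).
    by rewrite ler_wpM2r ?invr_ge0 // ler_nat; exact: cnt.
  by rewrite natrD mulrDl lerD2l; exact: U_le.
(* [W] meets every period, so its density is at least [1 / D]; the bound for [U] is smaller by the
   factor [2 ^ k.+1]. *)
suff : ((D * 2 ^ k.+1)%N%:R)^-1 < (count_upto W D)%:R / D%:R :> R by lra.
rewrite natrM invfM mulrC ltr_pM2r ?invr_gt0 ?ltr0n //.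
apply: lt_le_trans (_ : 1 <= _); last by rewrite ler1n.
by rewrite invf_lt1 ?ltr0n ?expn_gt0 // ltr1n -(expn0 2) ltn_exp2l.
Qed.

Lemma taut_construction : taut R (range b).
Proof.
move=> _ [k _ <-].
have [l dl] := subfamily_has_density setT.
have [l' dl'] := subfamily_has_density [set i | i != k].
rewrite -range_bD1 in dl'.
rewrite (has_density_log_density _ _ _ dl) (has_density_log_density _ _ _ dl').
exact: density_ltn _ _ _ dl dl'.
Qed.

End Construction.

Theorem theorem2 (R : realType) (S : set nat) (S_pos : S `<=` posnat)
    (S_min : minimal S) :
  exists B : set nat,
    [/\ B `<=` posnat, besicovitch R B, taut R B & star B = S].
Proof.
have [[s0 Ss0]|/set0P/negP/negPn/eqP S0] := pselect (S !=set0); last first.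
  (* An empty [S] has no enumeration. The empty set is vacuously taut, and its [D(B)] is empty
     because an infinite [A] has an element. *)
  exists set0; rewrite S0; split=> //.
  - exists 0; rewrite /has_density.
    under eq_fun => n.
      rewrite big_pred0; last first.
        by move=> k; apply/negbTE/negP => /set_mem/multiplesP[].
      rewrite mul0r; over.
    exact: cvg_cst.
  - apply/seteqP; split=> x //.
    move=> [[//|[_ [A [_ /infinite_setN0 [a Aa] _ sub]]]] _].
    by apply: (sub (x * a)%N); exists a.
have [t [tS t_rec]] := exists_recurrent_enumeration S s0 Ss0.
have [p pP] := exists_sparse_primes t.
have p_prime n : prime (p n) by case: (pP n).
have p_big n := proj2 (pP n).
exists (range (fun n => (t n * p n)%N)); split.
- by move=> _ [n _ <-]; exact: (b_gt0 S t p).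
- have [l dl] := subfamily_has_density S t p S_pos tS p_prime p_big R setT.
  by exists l.
- exact: (taut_construction S t p S_pos S_min.1).
- exact: (star_construction S t p S_pos S_min.1).
Qed.
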